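(* Suppose the regularity conditions (R), the open-loop stability condition (S), the simplifying conditions (E) and the tightened terminal conditions ($\bar{\mathrm{T}}$) stated in the context hold. Then there exist constants $\tilde\rho\in[0,1)$ and $c_{\mathrm{w}},\bar{c}_{\mathbb{X},1},\bar{c}_{\mathbb{X},2},\bar{c}_{\mathbb{X},3}\ge0$ such that for any initial condition $x_0\in\mathbb{R}^n$, weight $\lambda>0$, any disturbances $w(k)\in\mathbb{R}^n$, $k\in\mathbb{I}_{\ge0}$, and any time $T\in\mathbb{I}_{\ge0}$, the closed-loop system $x(k+1)=f(x(k),\pi_{\mathrm{rs}}(x(k)))+w(k)$, $x(0)=x_0$, satisfies $$V_{\mathrm{rs}}(x(k+1))\le\tilde\rho\,V_{\mathrm{rs}}(x(k))+\lambda c_{\mathrm{w}}\|w(k)\|_{\mathbb{W}}^2\quad\text{for all }k\in\mathbb{I}_{\ge0},$$ $$\sum_{k=0}^{T-1}\|x(k)\|_{\mathbb{X}}^2\le\bar{c}_{\mathbb{X},1}\|x_0\|_{\bar{\mathbb{X}}_N\oplus\underline{\Omega}_{\bar\delta}}^2+\frac{\bar{c}_{\mathbb{X},2}}{\lambda}+\bar{c}_{\mathbb{X},3}\sum_{k=0}^{T-1}\|w(k)\|_{\mathbb{W}}^2 .$$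
   Context: Notation. $\|\cdot\|$ is the Euclidean norm; for a set $\mathcal{A}\subset\mathbb{R}^n$, $\|x\|_{\mathcal{A}}=\inf_{s\in\mathcal{A}}\|x-s\|$. $\oplus$ is the Minkowski sum and $\ominus$ the Pontryagin difference, $A\ominus B=\{x\mid x+b\in A\ \forall b\in B\}$. $\mathbb{I}_{[a,b]}$ (resp. $\mathbb{I}_{\ge a}$) is the set of integers in $[a,b]$ (resp. $\ge a$). $\mathcal{K}_\infty$: continuous, strictly increasing, radially unbounded functions $\alpha:\mathbb{R}_{\ge0}\to\mathbb{R}_{\ge0}$ with $\alpha(0)=0$. System. $x(k+1)=f(x(k),u(k))+w(k)$, $x(0)=x_0\in\mathbb{R}^n$, with inputs $u(k)\in\mathbb{U}\subseteq\mathbb{R}^m$ and arbitrary (unbounded) disturbances $w(k)\in\mathbb{R}^n$. $\ell:\mathbb{R}^n\times\mathbb{U}\to\mathbb{R}_{\ge0}$ is a stage cost and $\mathbb{X}\subseteq\mathbb{R}^n$ is a closed state constraint set. A user-specified disturbance set is $\mathbb{W}=\{w\in\mathbb{R}^n\mid\|w\|\le\bar{w}\}$ with $\bar{w}>0$. (R) Regularity: there is $\alpha_\ell\in\mathcal{K}_\infty$ with $\ell(x,u)\ge\alpha_\ell(\|x\|+\|u\|)$ for all $(x,u)\in\mathbb{R}^n\times\mathbb{U}$; $f(0,0)=0$, $\ell(0,0)=0$, $0\in\mathrm{int}(\mathbb{U})$, $0\in\mathrm{int}(\mathbb{X})$; $f,\ell$ are continuous; $\mathbb{U}$ is compact. (S)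 Open-loop stability: $V_\delta:\mathbb{R}^n\times\mathbb{R}^n\to\mathbb{R}_{\ge0}$ is continuous and there are $\alpha_{\delta,1},\dots,\alpha_{\delta,4}\in\mathcal{K}_\infty$ such that for all $x,z,w\in\mathbb{R}^n$, $u\in\mathbb{U}$: $\alpha_{\delta,1}(\|x-z\|)\le V_\delta(x,z)\le\alpha_{\delta,2}(\|x-z\|)$ and $V_\delta(f(x,u)+w,f(z,u))-V_\delta(x,z)\le-\alpha_{\delta,3}(\|x-z\|)+\alpha_{\delta,4}(\|w\|)$. (E) Simplifying conditions: $\alpha_\ell(r)=c_\ell r^2$, $\alpha_{\mathrm{f}}(r)=c_{\mathrm{f}}r^2$ (with $\alpha_{\mathrm{f}}$ from ($\bar{\mathrm{T}}$)), and $\alpha_{\delta,i}(r)=c_{\delta,i}r^2$, $i\in\mathbb{I}_{[1,4]}$, are quadratic. Tightened constraints. Let $\rho_\delta=\sqrt{1-c_{\delta,3}/c_{\delta,2}}\in[0,1)$, $\bar\delta=\frac{\sqrt{c_{\delta,4}}}{1-\rho_\delta}\bar{w}>0$, $\underline{\Omega}_{\bar\delta}=\{x\in\mathbb{R}^n\mid c_{\delta,2}\|x\|^2\le\bar\delta^2\}$, $\bar\Omega_{\bar\delta}=\{x\in\mathbb{R}^n\mid c_{\delta,1}\|x\|^2\le\bar\delta^2\}$, and $\bar{\mathbb{X}}=\mathbb{X}\ominus\bar\Omega_{\bar\delta}$. Cost. Fix $N\in\mathbb{I}_{\ge1}$. For $x\in\mathbb{R}^n$ and $\mathbf{u}=(\mathbf{u}_0,\dots,\mathbf{u}_{N-1})\in\mathbb{U}^N$,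 $x_{\mathbf{u}}(k,x)$ is the state after $k$ steps of the undisturbed system ($w\equiv0$) started at $x_{\mathbf{u}}(0,x)=x$. Let $V_{\mathrm{f}}:\mathbb{R}^n\to\mathbb{R}_{\ge0}$ be continuous, $\bar{\mathbb{X}}_{\mathrm{f}}\subseteq\bar{\mathbb{X}}$ closed, and $\mathcal{J}_N(x,\mathbf{u})=\sum_{k=0}^{N-1}\ell(x_{\mathbf{u}}(k,x),\mathbf{u}_k)+V_{\mathrm{f}}(x_{\mathbf{u}}(N,x))$. $\bar{\mathbb{X}}_N\subseteq\bar{\mathbb{X}}$ is the set of $\bar{x}$ for which there is $\mathbf{u}\in\mathbb{U}^N$ with $x_{\mathbf{u}}(k,\bar{x})\in\bar{\mathbb{X}}$, $k\in\mathbb{I}_{[0,N-1]}$, and $x_{\mathbf{u}}(N,\bar{x})\in\bar{\mathbb{X}}_{\mathrm{f}}$. ($\bar{\mathrm{T}}$) Tightened terminal conditions: there are $k_{\mathrm{f}}:\bar{\mathbb{X}}_{\mathrm{f}}\to\mathbb{U}$ and $\alpha_{\mathrm{f}}\in\mathcal{K}_\infty$ such that for every $x\in\bar{\mathbb{X}}_{\mathrm{f}}$, with $u=k_{\mathrm{f}}(x)$, $x^+=f(x,u)$: $V_{\mathrm{f}}(x^+)\le V_{\mathrm{f}}(x)-\ell(x,u)$; $(x,u)\in\bar{\mathbb{X}}\times\mathbb{U}$; $x^+\in\bar{\mathbb{X}}_{\mathrm{f}}$; $V_{\mathrm{f}}(x)\le\alpha_{\mathrm{f}}(\|x\|)$.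 Moreover $0\in\mathrm{int}(\bar{\mathbb{X}}_{\mathrm{f}})$ and $\bar{\mathbb{X}}_N$ is compact. Robust relaxed MPC. For a weight $\lambda>0$, $V_{\mathrm{rs}}(x)$ is the minimum of $\mathcal{J}_N(\bar{x},\mathbf{u})+\lambda s^2$ over $\bar{x}\in\mathbb{R}^n$, $\mathbf{u}\in\mathbb{U}^N$, $s\in\mathbb{R}_{\ge0}$ subject to $x_{\mathbf{u}}(k,\bar{x})\in\bar{\mathbb{X}}$, $k\in\mathbb{I}_{[0,N-1]}$, $x_{\mathbf{u}}(N,\bar{x})\in\bar{\mathbb{X}}_{\mathrm{f}}$, and $\sqrt{V_\delta(x,\bar{x})}\le\bar\delta+s$. A minimizing input sequence is denoted $\mathbf{u}^*_{\mathrm{rs}}(x)$, and $\pi_{\mathrm{rs}}(x)=\mathbf{u}^*_{\mathrm{rs},0}(x)$ is its first element. *)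

(* Defs.v *)
From HB Require Import structures.
From mathcomp Require Export all_boot all_order all_algebra.
From mathcomp Require Export all_classical all_reals all_analysis.

Set Implicit Arguments.
Unset Strict Implicit.
Unset Printing Implicit Defensive.

Import Order.TTheory GRing.Theory Num.Theory.
Export numFieldNormedType.Exports.
Local Open Scope classical_set_scope.
Local Open Scope ring_scope.

(* R^n is 'rV[R]_n.  The norm `|x| that the library puts on matrices is the sup
   norm, so the Euclidean norm is defined here; the topology of 'rV[R]_n (used
   for continuity, closedness, compactness and interiors) is the usual one. *)
Definition enorm (R : realType) (n : nat) (x : 'rV[R]_n) : R :=
  Num.sqrt (\sum_(i < n) x 0 i ^+ 2).

(* On the empty set the library's inf gives the junk value 0. *)
Definition set_dist (R : realType) (n : nat) (A : set 'rV[R]_n) (x : 'rV[R]_n) : R :=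
  inf [set enorm (x - s) | s in A].

Definition minkowski_sum (R : realType) (n : nat) (A B : set 'rV[R]_n) : set 'rV[R]_n :=
  [set a + b | a in A & b in B].

Definition pontryagin_diff (R : realType) (n : nat) (A B : set 'rV[R]_n) : set 'rV[R]_n :=
  [set x | forall b, B b -> A (x + b)].

Definition eball (R : realType) (n : nat) (r : R) : set 'rV[R]_n :=
  [set w | enorm w <= r].

(* Functions R_{>=0} -> R_{>=0} are total functions R -> R of which only the
   restriction to [0, +oo) is constrained.  Values on [0, +oo) are nonnegative
   because alpha 0 = 0 and alpha is increasing there. *)
Definition class_Kinf (R : realType) (alpha : R -> R) : Prop :=
  [/\ {within `[0, +oo[, continuous alpha},
      (forall r s : R, 0 <= r -> r < s -> alpha r < alpha s),
      alpha 0 = 0 &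
      alpha r @[r --> +oo] --> +oo].

Definition quadratic (R : realType) (c : R) (alpha : R -> R) : Prop :=
  forall r : R, 0 <= r -> alpha r = c * r ^+ 2.

(* f and ell are total, but their values matter only for inputs in U. *)
Record regularity (R : realType) (n m : nat)
    (f : 'rV[R]_n -> 'rV[R]_m -> 'rV[R]_n) (ell : 'rV[R]_n -> 'rV[R]_m -> R)
    (U : set 'rV[R]_m) (X : set 'rV[R]_n) (alpha_l : R -> R) : Prop := Regularity {
  reg_Kinf : class_Kinf alpha_l;
  reg_lower : forall x u, U u -> alpha_l (enorm x + enorm u) <= ell x u;
  reg_f0 : f 0 0 = 0;
  reg_ell0 : ell 0 0 = 0;
  reg_int_U : U° 0;
  reg_int_X : X° 0;
  reg_cont_f :
    {within [set xu : 'rV[R]_n * 'rV[R]_m | U xu.2], continuous (fun xu => f xu.1 xu.2)};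
  reg_cont_ell :
    {within [set xu : 'rV[R]_n * 'rV[R]_m | U xu.2], continuous (fun xu => ell xu.1 xu.2)};
  reg_compact_U : compact U }.

Record open_loop_stability (R : realType) (n m : nat)
    (f : 'rV[R]_n -> 'rV[R]_m -> 'rV[R]_n) (U : set 'rV[R]_m)
    (Vd : 'rV[R]_n -> 'rV[R]_n -> R) (alpha1 alpha2 alpha3 alpha4 : R -> R) : Prop :=
    OpenLoopStability {
  ols_ge0 : forall x z, 0 <= Vd x z;
  ols_cont : continuous (fun xz : 'rV[R]_n * 'rV[R]_n => Vd xz.1 xz.2);
  ols_Kinf1 : class_Kinf alpha1;
  ols_Kinf2 : class_Kinf alpha2;
  ols_Kinf3 : class_Kinf alpha3;
  ols_Kinf4 : class_Kinf alpha4;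
  ols_bounds : forall x z,
    alpha1 (enorm (x - z)) <= Vd x z <= alpha2 (enorm (x - z));
  ols_decrease : forall x z w u, U u ->
    Vd (f x u + w) (f z u) - Vd x z <= - alpha3 (enorm (x - z)) + alpha4 (enorm w) }.

Definition rho_delta (R : realType) (c2 c3 : R) : R := Num.sqrt (1 - c3 / c2).

Definition delta_bar (R : realType) (c2 c3 c4 wbar : R) : R :=
  Num.sqrt c4 / (1 - rho_delta c2 c3) * wbar.

(* The inner set has c = c_{delta,2}, the outer set has c = c_{delta,1}. *)
Definition Omega (R : realType) (n : nat) (c delta : R) : set 'rV[R]_n :=
  [set x | c * enorm x ^+ 2 <= delta ^+ 2].

(* Input sequences are N-tuples; u`_k is the k-th entry, with default value 0
   for k >= N, so that traj is meaningful for k <= N. *)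
Fixpoint traj (R : realType) (n m N : nat) (f : 'rV[R]_n -> 'rV[R]_m -> 'rV[R]_n)
    (u : N.-tuple 'rV[R]_m) (x : 'rV[R]_n) (k : nat) : 'rV[R]_n :=
  if k is k'.+1 then f (traj f u x k') u`_k' else x.

Definition mpc_cost (R : realType) (n m N : nat)
    (f : 'rV[R]_n -> 'rV[R]_m -> 'rV[R]_n) (ell : 'rV[R]_n -> 'rV[R]_m -> R)
    (Vf : 'rV[R]_n -> R) (x : 'rV[R]_n) (u : N.-tuple 'rV[R]_m) : R :=
  \sum_(k < N) ell (traj f u x k) u`_k + Vf (traj f u x N).

Definition admissible (R : realType) (n m N : nat)
    (f : 'rV[R]_n -> 'rV[R]_m -> 'rV[R]_n) (U : set 'rV[R]_m)
    (Xb Xf : set 'rV[R]_n) (x : 'rV[R]_n) (u : N.-tuple 'rV[R]_m) : Prop :=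
  [/\ (forall k, (k < N)%N -> U u`_k),
      (forall k, (k < N)%N -> Xb (traj f u x k)) &
      Xf (traj f u x N)].

Definition feasible_set (R : realType) (n m : nat) (N : nat)
    (f : 'rV[R]_n -> 'rV[R]_m -> 'rV[R]_n) (U : set 'rV[R]_m)
    (Xb Xf : set 'rV[R]_n) : set 'rV[R]_n :=
  [set x | exists u : N.-tuple 'rV[R]_m, admissible f U Xb Xf x u].

Record tightened_terminal (R : realType) (n m : nat) (N : nat)
    (f : 'rV[R]_n -> 'rV[R]_m -> 'rV[R]_n) (ell : 'rV[R]_n -> 'rV[R]_m -> R)
    (U : set 'rV[R]_m) (Xb Xf : set 'rV[R]_n) (Vf : 'rV[R]_n -> R)
    (alpha_f : R -> R) : Prop := TightenedTerminal {
  tt_Kinf : class_Kinf alpha_f;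
  tt_local : exists kf : 'rV[R]_n -> 'rV[R]_m, forall x, Xf x ->
    [/\ Vf (f x (kf x)) <= Vf x - ell x (kf x),
        Xb x /\ U (kf x),
        Xf (f x (kf x)) &
        Vf x <= alpha_f (enorm x)];
  tt_int : Xf° 0;
  tt_compact : compact (feasible_set N f U Xb Xf) }.

Definition rs_feasible (R : realType) (n m N : nat)
    (f : 'rV[R]_n -> 'rV[R]_m -> 'rV[R]_n) (U : set 'rV[R]_m)
    (Xb Xf : set 'rV[R]_n) (Vd : 'rV[R]_n -> 'rV[R]_n -> R) (delta : R)
    (x xb : 'rV[R]_n) (u : N.-tuple 'rV[R]_m) (s : R) : Prop :=
  [/\ admissible f U Xb Xf xb u, 0 <= s & Num.sqrt (Vd x xb) <= delta + s].

Definition rs_cost (R : realType) (n m N : nat)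
    (f : 'rV[R]_n -> 'rV[R]_m -> 'rV[R]_n) (ell : 'rV[R]_n -> 'rV[R]_m -> R)
    (Vf : 'rV[R]_n -> R) (lambda : R)
    (xb : 'rV[R]_n) (u : N.-tuple 'rV[R]_m) (s : R) : R :=
  mpc_cost f ell Vf xb u + lambda * s ^+ 2.

(* The optimal value; it is a minimum wherever rs_minimizer is inhabited. *)
Definition V_rs (R : realType) (n m : nat) (N : nat)
    (f : 'rV[R]_n -> 'rV[R]_m -> 'rV[R]_n) (ell : 'rV[R]_n -> 'rV[R]_m -> R)
    (U : set 'rV[R]_m) (Xb Xf : set 'rV[R]_n) (Vf : 'rV[R]_n -> R)
    (Vd : 'rV[R]_n -> 'rV[R]_n -> R) (delta lambda : R) (x : 'rV[R]_n) : R :=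
  inf [set v | exists xb (u : N.-tuple 'rV[R]_m) s,
         rs_feasible f U Xb Xf Vd delta x xb u s /\ v = rs_cost f ell Vf lambda xb u s].

Definition rs_minimizer (R : realType) (n m N : nat)
    (f : 'rV[R]_n -> 'rV[R]_m -> 'rV[R]_n) (ell : 'rV[R]_n -> 'rV[R]_m -> R)
    (U : set 'rV[R]_m) (Xb Xf : set 'rV[R]_n) (Vf : 'rV[R]_n -> R)
    (Vd : 'rV[R]_n -> 'rV[R]_n -> R) (delta lambda : R)
    (x xb : 'rV[R]_n) (u : N.-tuple 'rV[R]_m) (s : R) : Prop :=
  rs_feasible f U Xb Xf Vd delta x xb u s /\
  forall xb' (u' : N.-tuple 'rV[R]_m) s',
    rs_feasible f U Xb Xf Vd delta x xb' u' s' ->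
    rs_cost f ell Vf lambda xb u s <= rs_cost f ell Vf lambda xb' u' s'.

(* Main.v *)
Require Import Defs.
From mathcomp Require Import all_boot all_order all_algebra.
From mathcomp Require Import all_classical all_reals all_analysis.
From mathcomp Require Import ring lra.

Import Order.TTheory GRing.Theory Num.Theory.
Import numFieldNormedType.Exports.
Local Open Scope classical_set_scope.
Local Open Scope ring_scope.

(** The closed loop is analysed with the optimal value V_rs as a Lyapunov
    function, whose two parts decrease separately in one time step.

    Let (xb, u, s) be optimal at x, and let x+ = f x u_0 + w be the next state.
    The candidate at x+ starts from the nominal successor f xb u_0, shifts the
    inputs and appends the terminal controller (admissible_shift).  The square
    root of Vd is a contraction with factor rho up to sqrt c_4 |w|
    (sqrt_Vd_contract), and the tube radius delta is the fixed point of
    d |-> rho d + sqrt c_4 wbar.  Hence a disturbance of norm up to wbar is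
    absorbed by the tube, and rho s + sqrt c_4 |w|_W is a feasible slack
    (rs_feasible_step).  The slack part of the value thus contracts.  The nominal
    part J decreases by the first stage cost, which is at least c_l |xb|^2; and
    J is at most C |xb|^2, because close to the origin the terminal controller
    is available and elsewhere J is bounded by compactness
    (mpc_cost_quadratic_bound).  So J contracts as well (V_rs_decrease).  The
    weight lambda enters neither factor.

    Slack bounds constraint violation: xb lies in the constraint set shrunk by
    the tube, so x is at distance at most s / sqrt c_1 from X
    (set_dist_pontryagin), and lambda s^2 <= V_rs.  Summing the decrease of V_rs
    over time and bounding the initial value by
    M + lambda c_2 dist(x_0)^2 (V_rs_upper) gives the estimate of the sum of the
    squared violations; the division by lambda leaves M / lambda.

    Existence of minimizers and the bound M on the nominal cost both come from
    compactness.  The cost of an input sequence depends only on its initial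
    state, terminal state and accumulated stage cost, and the set of these
    triples is compact as an iterated continuous image of compact sets
    (compact_reach). *)

(** * The Euclidean norm and the distance to a set *)

Section EuclideanNorm.
#[local] Set Implicit Arguments.
#[local] Unset Strict Implicit.
Context {R : realType} {n : nat}.
Implicit Types (x y : 'rV[R]_n) (A : set 'rV[R]_n).

Lemma sqrtr_le_sqr (a b : R) : 0 <= b -> a <= b ^+ 2 -> Num.sqrt a <= b.
Proof. by move=> b0 ab; rewrite -[leRHS]ger0_norm// -sqrtr_sqr ler_wsqrtr. Qed.

Lemma enorm_ge0 x : 0 <= enorm x.
Proof. exact: sqrtr_ge0. Qed.

Lemma sqr_enorm x : enorm x ^+ 2 = \sum_(i < n) x 0 i ^+ 2.
Proof. by rewrite sqr_sqrtr// sumr_ge0// => i _; exact: sqr_ge0. Qed.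

Lemma enormZ (a : R) x : 0 <= a -> enorm (a *: x) = a * enorm x.
Proof.
move=> a0; rewrite /enorm -{2}[a]ger0_norm// -sqrtr_sqr -sqrtrM ?sqr_ge0//.
by congr Num.sqrt; rewrite mulr_sumr; apply: eq_bigr => i _; rewrite mxE exprMn.
Qed.

Lemma enorm0 : enorm (0 : 'rV[R]_n) = 0.
Proof. by rewrite -(scale0r 0) enormZ// mul0r. Qed.

Lemma norm_le_enorm x : `|x| <= enorm x.
Proof.
rewrite /Num.norm/= mx_normrE; apply/bigmax_leP; split=> [|[i j] _] /=.
  exact: enorm_ge0.
rewrite ord1 -sqrtr_sqr ler_wsqrtr// (bigD1 j)//= lerDl sumr_ge0// => k _.
exact: sqr_ge0.
Qed.

Lemma enorm_eq0 x : enorm x = 0 -> x = 0.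
Proof.
by move=> x0; apply/eqP; rewrite -normr_le0 -x0; exact: norm_le_enorm.
Qed.

(** Cauchy-Schwarz, summed from the weighted bound
    2 a b <= (q / p) a^2 + (p / q) b^2 with p and q the two norms. *)
Lemma dot_le_enorm x y : \sum_(i < n) x 0 i * y 0 i <= enorm x * enorm y.
Proof.
have [x0|x0] := eqVneq (enorm x) 0.
  by rewrite x0 mul0r (enorm_eq0 x0) big1// => i _; rewrite mxE mul0r.
have [y0|y0] := eqVneq (enorm y) 0.
  by rewrite y0 mulr0 (enorm_eq0 y0) big1// => i _; rewrite mxE mulr0.
have xp : 0 < enorm x by rewrite lt0r x0 enorm_ge0.
have yp : 0 < enorm y by rewrite lt0r y0 enorm_ge0.
set p := enorm x in x0 xp *; set q := enorm y in y0 yp *.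
have pq0 : 0 < p * q by rewrite mulr_gt0.
rewrite -(ler_pM2l pq0) -(ler_pM2l (ltr0n R 2)) mulr_sumr mulr_sumr.
have -> : 2 * (p * q * (p * q)) =
    \sum_(i < n) (q ^+ 2 * x 0 i ^+ 2 + p ^+ 2 * y 0 i ^+ 2).
  by rewrite big_split/= -!mulr_sumr -!sqr_enorm -/p -/q; ring.
apply: ler_sum => i _; rewrite -subr_ge0.
have -> : q ^+ 2 * x 0 i ^+ 2 + p ^+ 2 * y 0 i ^+ 2 -
   2 * (p * q * (x 0 i * y 0 i)) = (q * x 0 i - p * y 0 i) ^+ 2 by ring.
exact: sqr_ge0.
Qed.

Lemma ler_enormD x y : enorm (x + y) <= enorm x + enorm y.
Proof.
apply: sqrtr_le_sqr; first by rewrite addr_ge0// enorm_ge0.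
under eq_bigr do rewrite mxE sqrrD.
rewrite !big_split/= -!sqr_enorm sqrrD lerD2r lerD2l -mulr2n lerMn2r/=.
exact: dot_le_enorm.
Qed.

Lemma set_dist_ge0 A x : 0 <= set_dist A x.
Proof.
have [[_ [s As _]]|A0] := pselect ([set enorm (x - s) | s in A] !=set0).
  apply: lb_le_inf; first by exists (enorm (x - s)); exists s.
  by move=> _ [t _ <-]; exact: enorm_ge0.
rewrite /set_dist; have -> : [set enorm (x - s) | s in A] = set0.
  by rewrite -subset0 => y Ay; apply: A0; exists y.
by rewrite inf0.
Qed.

Lemma set_dist_le A x s : A s -> set_dist A x <= enorm (x - s).
Proof.
move=> As; apply: ge_inf; last by exists s.
by exists 0 => _ [t _ <-]; exact: enorm_ge0.
Qed.

Lemma le_set_dist A x (a : R) :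
  A !=set0 -> (forall s, A s -> a <= enorm (x - s)) -> a <= set_dist A x.
Proof.
move=> [s As] Ha; apply: lb_le_inf; first by exists (enorm (x - s)); exists s.
by move=> _ [t At <-]; exact: Ha.
Qed.

(** For a > 0 the hypothesis says that sqrt (a / c) is a lower bound of the
    distances from x to the points of A, so it passes to the infimum. *)
Lemma le_set_dist_sqr A x (a c : R) : A !=set0 -> 0 < c ->
  (forall s, A s -> a <= c * enorm (x - s) ^+ 2) -> a <= c * set_dist A x ^+ 2.
Proof.
move=> A0 c0 Ha; have [a0|a0] := leP a 0.
  by rewrite (le_trans a0)// mulr_ge0 ?sqr_ge0// ltW.
rewrite mulrC -ler_pdivrMr// -[leLHS]sqr_sqrtr ?divr_ge0 ?(ltW a0) ?(ltW c0)//.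
rewrite ler_sqr ?nnegrE ?sqrtr_ge0 ?set_dist_ge0//.
apply: le_set_dist => // s As; apply: sqrtr_le_sqr; first exact: enorm_ge0.
by rewrite ler_pdivrMr// mulrC Ha.
Qed.

Lemma enorm_le_eball_dist (r : R) x :
  0 <= r -> enorm x <= r + set_dist (eball r) x.
Proof.
move=> r0; rewrite -lerBlDl; apply: le_set_dist.
  by exists 0; rewrite /eball/= enorm0.
move=> s; rewrite /eball/= => sr; rewrite lerBlDl -{1}[x](subrK s) addrC.
by rewrite (le_trans (ler_enormD _ _))// lerD2r.
Qed.

End EuclideanNorm.

(** * Trajectories and shifted input sequences *)

Section Trajectories.
#[local] Set Implicit Arguments.
#[local] Unset Strict Implicit.
Context {R : realType} {n m : nat}.
Variables (f : 'rV[R]_n -> 'rV[R]_m -> 'rV[R]_n)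
  (ell : 'rV[R]_n -> 'rV[R]_m -> R).
Variables (U : set 'rV[R]_m) (Xb Xf : set 'rV[R]_n) (Vf : 'rV[R]_n -> R).

Lemma eq_traj N N' (u : N.-tuple 'rV[R]_m) (u' : N'.-tuple 'rV[R]_m) x k :
  (forall i, (i < k)%N -> u`_i = u'`_i) -> traj f u x k = traj f u' x k.
Proof.
elim: k => //= k IH uu'; rewrite IH ?uu'// => i ik.
by rewrite uu'// (ltn_trans ik).
Qed.

Lemma traj_shift N (u u' : N.-tuple 'rV[R]_m) x k :
  (forall i, (i < k)%N -> u'`_i = u`_i.+1) ->
  traj f u' (f x u`_0) k = traj f u x k.+1.
Proof.
elim: k => //= k IH uu'; rewrite IH ?uu'// => i ik.
by rewrite uu'// (ltn_trans ik).
Qed.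

Lemma nth_mktuple_nat (N : nat) (g : nat -> 'rV[R]_m) k :
  (k < N)%N -> [tuple g i | i < N]`_k = g k.
Proof. by move=> kN; rewrite -[k in LHS]/(val (Ordinal kN)) nth_mktuple. Qed.

Lemma mpc_costE N x (u : N.-tuple 'rV[R]_m) :
  mpc_cost f ell Vf x u =
  \sum_(0 <= i < N) ell (traj f u x i) u`_i + Vf (traj f u x N).
Proof. by rewrite /mpc_cost big_mkord. Qed.

(** The standard candidate of the next time step: drop the first input and
    apply v at the terminal state.  The stage cost of the first step leaves
    the sum, and the cost of the additional step enters it. *)
Lemma admissible_shift N x (u : N.-tuple 'rV[R]_m) v : (0 < N)%N ->
  admissible f U Xb Xf x u -> U v ->
  Xb (traj f u x N) -> Xf (f (traj f u x N) v) ->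
  exists u' : N.-tuple 'rV[R]_m, admissible f U Xb Xf (f x u`_0) u' /\
    mpc_cost f ell Vf (f x u`_0) u' + ell x u`_0 + Vf (traj f u x N) =
    mpc_cost f ell Vf x u + ell (traj f u x N) v + Vf (f (traj f u x N) v).
Proof.
case: N u => // N u _ [uU uX uf] vU zX zf.
pose g i := if (i < N)%N then u`_i.+1 else v.
pose u' := [tuple g i | i < N.+1].
have u'E i : (i < N)%N -> u'`_i = u`_i.+1.
  by move=> iN; rewrite (nth_mktuple_nat g) /g ?iN// ltnW.
have u'N : u'`_N = v by rewrite (nth_mktuple_nat g) /g ?ltnn.
have tE i : (i <= N)%N -> traj f u' (f x u`_0) i = traj f u x i.+1.
  by move=> iN; apply: traj_shift => j ji; rewrite u'E// (leq_trans ji).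
have tN : traj f u' (f x u`_0) N.+1 = f (traj f u x N.+1) v.
  by rewrite [LHS]/= u'N tE.
exists u'; split.
  split=> [k|k|]; last by rewrite tN.
    rewrite ltnS leq_eqVlt => /predU1P[->|kN]; first by rewrite u'N.
    by rewrite u'E//; exact: uU.
  rewrite ltnS leq_eqVlt => /predU1P[->|kN]; first by rewrite tE.
  by rewrite (tE _ (ltnW kN)); exact: uX.
rewrite !mpc_costE tN.
rewrite big_nat_recr//= u'N tE// [in RHS]big_nat_recl//=.
under eq_big_nat => i /andP[_ iN] do rewrite u'E// tE ?(ltnW iN)//.
ring.
Qed.

(** Apply the terminal controller at every step: the state stays in Xf, and the
    decrease of Vf by the stage cost telescopes. *)
Lemma admissible_terminal N (kf : 'rV[R]_n -> 'rV[R]_m) x :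
  (forall z, Xf z -> [/\ Vf (f z (kf z)) <= Vf z - ell z (kf z),
     Xb z, U (kf z) & Xf (f z (kf z))]) ->
  Xf x ->
  exists2 u : N.-tuple 'rV[R]_m,
    admissible f U Xb Xf x u & mpc_cost f ell Vf x u <= Vf x.
Proof.
move=> loc xf; pose z k := iter k (fun y => f y (kf y)) x.
have zf k : Xf (z k) by elim: k => //= k /loc[].
pose u := [tuple kf (z i) | i < N].
have uE i : (i < N)%N -> u`_i = kf (z i)
  by move=> iN; exact: (nth_mktuple_nat (kf \o z)).
have tE k : (k <= N)%N -> traj f u x k = z k.
  by elim: k => //= k IH kN; rewrite IH ?uE// ltnW.
exists u; first split.
- by move=> k kN; rewrite uE//; have [] := loc _ (zf k).
- by move=> k kN; rewrite tE ?(ltnW kN)//; have [] := loc _ (zf k).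
- by rewrite tE.
rewrite mpc_costE tE//.
under eq_big_nat => i /andP[_ iN] do rewrite uE// tE ?(ltnW iN)//.
have {uE tE u} : forall k,
    \sum_(0 <= i < k) ell (z i) (kf (z i)) + Vf (z k) <= Vf x.
  elim=> [|k IH]; first by rewrite big_nil add0r.
  have [decr _ _ _] := loc _ (zf k).
  rewrite big_nat_recr//= -addrA (le_trans _ IH)// lerD2l.
  by rewrite -lerBrDl.
exact.
Qed.

End Trajectories.

(** * Compactness of the set of admissible trajectories *)

Lemma continuous_fst_comp {T A B : topologicalType} (h : T -> A * B) :
  continuous h -> continuous (fun x => (h x).1).
Proof.
by move=> ch x; apply: (@continuous_comp _ _ _ h fst x (ch x)); exact: cvg_fst.
Qed.

Lemma continuous_snd_comp {T A B : topologicalType} (h : T -> A * B) :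
  continuous h -> continuous (fun x => (h x).2).
Proof.
by move=> ch x; apply: (@continuous_comp _ _ _ h snd x (ch x)); exact: cvg_snd.
Qed.

Lemma continuous_pair {T A B : topologicalType} (g : T -> A) (h : T -> B) :
  continuous g -> continuous h -> continuous (fun x => (g x, h x)).
Proof. by move=> cg ch x; apply: cvg_pair; [exact: cg|exact: ch]. Qed.

Lemma within_continuous_pre {T1 T2 T3 : topologicalType} (A : set T1) (B : set T2)
    (g : T1 -> T2) (h : T2 -> T3) :
  continuous g -> (forall x, A x -> B (g x)) ->
  {within B, continuous h} -> {within A, continuous (h \o g)}.
Proof.
move=> cg AB /subspace_continuousP ch; apply/subspace_continuousP => x Ax.
apply: (cvg_trans _ (ch (g x) (AB _ Ax))) => /= V /=.
rewrite !nbhs_simpl /within/= => gV.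
have := cg x _ gV; rewrite !nbhs_simpl /=.
by apply: filterS => y /= hy Ay; apply: hy; exact: AB.
Qed.

Section Reach.
#[local] Set Implicit Arguments.
#[local] Unset Strict Implicit.
Context {R : realType} {n m : nat}.
Variables (f : 'rV[R]_n -> 'rV[R]_m -> 'rV[R]_n)
  (ell : 'rV[R]_n -> 'rV[R]_m -> R).
Variables (U : set 'rV[R]_m) (Xb : set 'rV[R]_n).

(** The input sequence is quantified away: the triple of initial state, current
    state and accumulated cost is enough to continue, so that one more time step
    is one continuous image, and no topology on sequences is involved. *)
Definition reach N (K : set 'rV[R]_n) (k : nat) : set ('rV[R]_n * 'rV[R]_n * R) :=
  [set p | exists u : N.-tuple 'rV[R]_m,
    [/\ K p.1.1,
        forall i, (i < k)%N -> U u`_i /\ Xb (traj f u p.1.1 i),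
        p.1.2 = traj f u p.1.1 k &
        p.2 = \sum_(0 <= i < k) ell (traj f u p.1.1 i) u`_i]].

Let step (q : ('rV[R]_n * 'rV[R]_n * R) * 'rV[R]_m) :=
  ((q.1.1.1, f q.1.1.2 q.2), q.1.2 + ell q.1.1.2 q.2).

Lemma reach0 N K : reach N K 0 = (fun x => ((x, x), 0)) @` K.
Proof.
apply/seteqP; split=> [[[x z] c] [u [/= Kx _ -> ->]]|_ [x Kx <-]] /=.
  by exists x => //; rewrite big_nil.
by exists [tuple 0 | i < N]; split=> //=; rewrite big_nil.
Qed.

Lemma reachS N K k : (k < N)%N ->
  reach N K k.+1 =
  step @` ((reach N K k `&` [set p | Xb p.1.2]) `*` U).
Proof.
move=> kN; apply/seteqP; split=> [[[x z] c] [u [/= Kx ux -> ->]]|].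
  have [uk xk] := ux k (ltnSn k).
  exists ((x, traj f u x k, \sum_(0 <= i < k) ell (traj f u x i) u`_i), u`_k).
    split=> //; split=> //=; exists u; split=> //= i ik.
    exact/ux/ltnW.
  by rewrite /step/= [in RHS]big_nat_recr.
move=> _ [[[[x z] c] v] [[[u [/= Kx ux zE cE]] /= zX] /= vU] <-].
pose g i := if (i < k)%N then u`_i else v.
pose u' := [tuple g i | i < N].
have u'E i : (i < k)%N -> u'`_i = u`_i.
  by move=> ik; rewrite (nth_mktuple_nat g) /g ?ik// (ltn_trans ik).
have u'k : u'`_k = v by rewrite (nth_mktuple_nat g) /g ?ltnn.
have tE i : (i <= k)%N -> traj f u' x i = traj f u x i.
  by move=> ik; apply: eq_traj => j ji; rewrite u'E// (leq_trans ji).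
exists u'; split=> //=.
- move=> i; rewrite ltnS leq_eqVlt => /predU1P[->|ik].
    by rewrite u'k tE// -zE.
  by rewrite u'E// (tE _ (ltnW ik)); exact: ux.
- by rewrite u'k tE// -zE.
- rewrite big_nat_recr//= u'k tE// -zE cE; congr (_ + _).
  by apply: eq_big_nat => i /andP[_ ik]; rewrite u'E// (tE _ (ltnW ik)).
Qed.

Hypothesis cont_f :
  {within [set xu : 'rV[R]_n * 'rV[R]_m | U xu.2], continuous (fun xu => f xu.1 xu.2)}.
Hypothesis cont_ell :
  {within [set xu : 'rV[R]_n * 'rV[R]_m | U xu.2], continuous (fun xu => ell xu.1 xu.2)}.
Hypothesis compact_U : compact U.
Hypothesis closed_Xb : closed Xb.

Let continuous_step (A : set ('rV[R]_n * 'rV[R]_n * R)) :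
  {within A `*` U, continuous step}.
Proof.
pose T := (('rV[R]_n * 'rV[R]_n * R) * 'rV[R]_m)%type.
pose g (q : T) := (q.1.1.2, q.2).
have c1 : continuous (fun q : T => q.1) by apply: continuous_fst_comp => q.
have c11 : continuous (fun q : T => q.1.1) by exact: continuous_fst_comp.
have c111 : continuous (fun q : T => q.1.1.1) by exact: continuous_fst_comp.
have c12 : continuous (fun q : T => q.1.2) by exact: continuous_snd_comp.
have cg : continuous g.
  apply: continuous_pair; first exact: continuous_snd_comp.
  by apply: continuous_snd_comp => q.
have gU q : (A `*` U) q -> [set xu : 'rV[R]_n * 'rV[R]_m | U xu.2] (g q).
  by case.
have cf := @within_continuous_pre _ _ _ _ _ _ _ cg gU cont_f.
have cl := @within_continuous_pre _ _ _ _ _ _ _ cg gU cont_ell.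
move/subspace_continuousP in cf; move/subspace_continuousP in cl.
apply/subspace_continuousP => q qA.
have h1 : q.1.1.1 @[q --> within (A `*` U) (nbhs q)] --> q.1.1.1.
  by apply: cvg_within_filter; exact: c111.
have h2 : q.1.2 @[q --> within (A `*` U) (nbhs q)] --> q.1.2.
  by apply: cvg_within_filter; exact: c12.
have h3 : q.1.2 + ell q.1.1.2 q.2 @[q --> within (A `*` U) (nbhs q)] -->
    q.1.2 + ell q.1.1.2 q.2 by apply: cvgD => //; exact: (cl q qA).
have h4 : (q.1.1.1, f q.1.1.2 q.2) @[q --> within (A `*` U) (nbhs q)] -->
    (q.1.1.1, f q.1.1.2 q.2) by exact: cvg_pair h1 (cf q qA).
exact: cvg_pair h4 h3.
Qed.

(** The closed constraint cuts a compact set out of the triples after k steps,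
    and f and ell are continuous on its product with the compact set U. *)
Lemma compact_reach N K k : compact K -> (k <= N)%N -> compact (reach N K k).
Proof.
move=> cK; elim: k => [_|k IH kN].
  rewrite reach0; apply: continuous_compact => //.
  apply: continuous_subspaceT; apply: continuous_pair.
    by apply: continuous_pair => x.
  exact: cst_continuous.
rewrite reachS//; apply: continuous_compact; first exact: continuous_step.
apply: compact_setX => //; apply: compact_closedI; first exact/IH/ltnW.
apply: (closed_comp _ closed_Xb) => p _; move: p.
by apply: continuous_snd_comp; apply: continuous_fst_comp => p.
Qed.

End Reach.

(** * The optimal control problem *)

Section OptimalControl.
#[local] Set Implicit Arguments.
#[local] Unset Strict Implicit.
Context {R : realType} {n m : nat} (N : nat).
Variables (f : 'rV[R]_n -> 'rV[R]_m -> 'rV[R]_n)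
  (ell : 'rV[R]_n -> 'rV[R]_m -> R).
Variables (U : set 'rV[R]_m) (Xb Xf : set 'rV[R]_n) (Vf : 'rV[R]_n -> R).
Variables (Vd : 'rV[R]_n -> 'rV[R]_n -> R) (delta : R).

Let XN := feasible_set N f U Xb Xf.

(** All that the objective depends on: minimizing over input sequences is
    minimizing over this set. *)
Definition outcomes : set ('rV[R]_n * 'rV[R]_n * R) :=
  reach f ell U Xb N XN N `&` [set p | Xf p.1.2].

Lemma outcomes_admissible p : outcomes p ->
  exists2 u : N.-tuple 'rV[R]_m,
    admissible f U Xb Xf p.1.1 u & mpc_cost f ell Vf p.1.1 u = p.2 + Vf p.1.2.
Proof.
move=> [[u [_ ux zE cE]] /= zf]; exists u; last by rewrite mpc_costE -cE -zE.
by split=> [k /ux[]|k /ux[]|]//; rewrite -zE.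
Qed.

Lemma admissible_outcomes x (u : N.-tuple 'rV[R]_m) :
  admissible f U Xb Xf x u ->
  exists2 p, outcomes p &
    p.1.1 = x /\ mpc_cost f ell Vf x u = p.2 + Vf p.1.2.
Proof.
move=> ux; exists ((x, traj f u x N),
    \sum_(0 <= i < N) ell (traj f u x i) u`_i); last by rewrite mpc_costE.
have [uU uX uf] := ux; split=> //; exists u; split=> //=; first by exists u.
by move=> i iN; split; [exact: uU|exact: uX].
Qed.

Hypothesis cont_f :
  {within [set xu : 'rV[R]_n * 'rV[R]_m | U xu.2], continuous (fun xu => f xu.1 xu.2)}.
Hypothesis cont_ell :
  {within [set xu : 'rV[R]_n * 'rV[R]_m | U xu.2], continuous (fun xu => ell xu.1 xu.2)}.
Hypothesis compact_U : compact U.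
Hypothesis closed_Xb : closed Xb.
Hypothesis closed_Xf : closed Xf.
Hypothesis cont_Vf : continuous Vf.
Hypothesis compact_XN : compact XN.
Hypothesis XN_neq0 : XN !=set0.

Lemma compact_outcomes : compact outcomes.
Proof.
apply: compact_closedI; first exact: compact_reach.
apply: (closed_comp _ closed_Xf) => p _; move: p.
by apply: continuous_snd_comp; apply: continuous_fst_comp => p.
Qed.

Lemma outcomes_neq0 : outcomes !=set0.
Proof. by have [x [u /admissible_outcomes[p ? _]]] := XN_neq0; exists p. Qed.

Let continuous_nominal :
  continuous (fun p : 'rV[R]_n * 'rV[R]_n * R => p.2 + Vf p.1.2).
Proof.
move=> p; apply: cvgD; first by apply: continuous_snd_comp => q.
apply: (@continuous_comp _ _ _ (fun p : 'rV[R]_n * 'rV[R]_n * R => p.1.2) Vf).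
  by apply: continuous_snd_comp; apply: continuous_fst_comp => q.
exact: cont_Vf.
Qed.

Lemma mpc_cost_bounded :
  exists M, forall x (u : N.-tuple 'rV[R]_m),
    admissible f U Xb Xf x u -> mpc_cost f ell Vf x u <= M.
Proof.
have [p _ pmax] := compact_EVT_max outcomes_neq0 compact_outcomes
  (continuous_subspaceT continuous_nominal).
exists (p.2 + Vf p.1.2) => x u /admissible_outcomes[q oq [_ ->]].
by apply: pmax; rewrite inE.
Qed.

Hypothesis cont_Vd : continuous (fun xz : 'rV[R]_n * 'rV[R]_n => Vd xz.1 xz.2).

(** For a given initial state of the nominal trajectory the best slack is the
    excess of sqrt (Vd x xb) over delta, or 0.  With this slack the objective
    is a continuous function on the compact set of outcomes. *)
Lemma exists_rs_minimizer (lambda : R) x : 0 <= lambda ->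
  exists xb (u : N.-tuple 'rV[R]_m) s,
    rs_minimizer f ell U Xb Xf Vf Vd delta lambda x xb u s.
Proof.
move=> l0.
pose sl xb := Num.max (Num.sqrt (Vd x xb) - delta) 0.
pose phi (p : 'rV[R]_n * 'rV[R]_n * R) :=
  p.2 + Vf p.1.2 + lambda * (sl p.1.1 * sl p.1.1).
have cphi : continuous phi.
  have csl : continuous (fun p : 'rV[R]_n * 'rV[R]_n * R => sl p.1.1).
    move=> p; apply: (@continuous_comp _ _ _
      (fun p : 'rV[R]_n * 'rV[R]_n * R => p.1.1) sl).
      by apply: continuous_fst_comp; apply: continuous_fst_comp => q.
    apply: (@continuous_max _ _ (fun y => Num.sqrt (Vd x y) - delta) (cst 0));
      last exact: cst_continuous.
    apply: (@continuousB _ _ _ (fun y => Num.sqrt (Vd x y)) (cst delta));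
      last exact: cst_continuous.
    apply: (@continuous_comp _ _ _ (Vd x) Num.sqrt); last exact: sqrt_continuous.
    apply: (@continuous_comp _ _ _ (fun y => (x, y)) (fun xz => Vd xz.1 xz.2)).
      by apply: continuous_pair; [exact: cst_continuous|move=> z].
    exact: cont_Vd.
  move=> p; apply: cvgD; first exact: continuous_nominal.
  by apply: cvgM; [exact: cvg_cst|apply: cvgM; exact: csl].
have [p /set_mem op pmin] := compact_EVT_min outcomes_neq0
  compact_outcomes (continuous_subspaceT cphi).
have [u ux uc] := outcomes_admissible op.
have sl0 y : 0 <= sl y by rewrite le_max lexx orbT.
exists p.1.1, u, (sl p.1.1); split.
  by split=> //; rewrite -lerBlDl le_max lexx.
move=> xb' u' s' [u'x s'0 s'd].
have [q oq [qE u'c]] := admissible_outcomes u'x.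
rewrite /rs_cost uc u'c !expr2 (le_trans (pmin q _)) ?inE// /phi qE.
rewrite lerD2l ler_wpM2l//; apply: ler_pM => //.
  by rewrite ge_max s'0 andbT lerBlDl.
by rewrite ge_max s'0 andbT lerBlDl.
Qed.

End OptimalControl.

(** * Slack, decrease and upper bound of the relaxed value *)

(** Convexity of the square at s and b / (1 - rho) with weights rho, 1 - rho. *)
Lemma sqr_contraction_le {R : realType} (rho s b : R) : 0 <= rho < 1 ->
  (rho * s + b) ^+ 2 <= rho * s ^+ 2 + b ^+ 2 / (1 - rho).
Proof.
move=> /andP[r0 r1]; have d0 : 0 < 1 - rho by rewrite subr_gt0.
rewrite -subr_ge0.
have -> : rho * s ^+ 2 + b ^+ 2 / (1 - rho) - (rho * s + b) ^+ 2 =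
    rho * (1 - rho) * (s - b / (1 - rho)) ^+ 2.
  by field; rewrite gt_eqF.
by rewrite mulr_ge0 ?sqr_ge0// mulr_ge0// ltW.
Qed.

Lemma sum_le_of_contraction {R : realType} (rho : R) (a e : nat -> R) T :
  (forall k, 0 <= a k) -> (forall k, a k.+1 <= rho * a k + e k) ->
  (1 - rho) * (\sum_(0 <= k < T) a k) <= a 0%N + \sum_(0 <= k < T) e k.
Proof.
move=> a0 adecr.
(* keeping a T on the left closes the induction *)
suff : (1 - rho) * (\sum_(0 <= k < T) a k) + a T <=
    a 0%N + \sum_(0 <= k < T) e k.
  by apply: le_trans; rewrite lerDl.
elim: T => [|T IH]; first by rewrite !big_nil mulr0 add0r addr0.
rewrite !big_nat_recr//=; move: IH (adecr T); set S := \sum_(_ <= _ < _) a _.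
by set S' := \sum_(_ <= _ < _) e _; lra.
Qed.

(** The point at the fraction delta / (delta + s) of the segment from z to x
    lies in z + Omega c delta, hence in A; the remaining fraction s / (delta + s)
    of the segment turns (delta + s)^2 into s^2. *)
Lemma set_dist_pontryagin {R : realType} {n : nat} (A : set 'rV[R]_n)
    (c delta s : R) (x z : 'rV[R]_n) : 0 < delta -> 0 <= s ->
  pontryagin_diff A (Omega c delta) z ->
  c * enorm (x - z) ^+ 2 <= (delta + s) ^+ 2 ->
  0 <= c -> c * set_dist A x ^+ 2 <= s ^+ 2.
Proof.
move=> d0 s0 Az xz c0; have ds : 0 < delta + s by rewrite ltr_wpDr.
pose t := delta / (delta + s); have t0 : 0 <= t by rewrite divr_ge0 ?ltW.
have t1 : 0 <= 1 - t by rewrite subr_ge0 ler_pdivrMr// mul1r lerDl.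
have Ap : A (z + t *: (x - z)).
  apply: Az; rewrite /Omega/= enormZ// exprMn mulrCA.
  rewrite (le_trans (ler_wpM2l (sqr_ge0 t) xz))// -exprMn.
  by rewrite /t divfK ?gt_eqF.
have xp : x - (z + t *: (x - z)) = (1 - t) *: (x - z).
  by rewrite scalerBl scale1r opprD addrA.
have dle := set_dist_le x Ap; rewrite xp enormZ// in dle.
have -> : s = (1 - t) * (delta + s) by rewrite /t; field; rewrite gt_eqF.
rewrite exprMn (@le_trans _ _ (c * ((1 - t) * enorm (x - z)) ^+ 2))//.
  by apply: ler_wpM2l => //; rewrite ler_sqr ?nnegrE ?set_dist_ge0 ?mulr_ge0
    ?enorm_ge0.
by rewrite exprMn mulrCA ler_wpM2l ?sqr_ge0.
Qed.

Section RelaxedProblem.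
#[local] Set Implicit Arguments.
#[local] Unset Strict Implicit.
Context {R : realType} {n m N : nat}.
Variables (f : 'rV[R]_n -> 'rV[R]_m -> 'rV[R]_n)
  (ell : 'rV[R]_n -> 'rV[R]_m -> R).
Variables (U : set 'rV[R]_m) (Xb Xf : set 'rV[R]_n) (Vf : 'rV[R]_n -> R).
Variables (Vd : 'rV[R]_n -> 'rV[R]_n -> R) (delta lambda : R).

Lemma rs_minimizer_V_rs x xb (u : N.-tuple 'rV[R]_m) s :
  rs_minimizer f ell U Xb Xf Vf Vd delta lambda x xb u s ->
  V_rs N f ell U Xb Xf Vf Vd delta lambda x = rs_cost f ell Vf lambda xb u s.
Proof.
move=> [feas opt]; apply/le_anti/andP; split.
  apply: ge_inf; last by exists xb, u, s.
  exists (rs_cost f ell Vf lambda xb u s) => _ [xb' [u' [s' [feas' ->]]]].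
  exact: opt.
apply: lb_le_inf; first by exists (rs_cost f ell Vf lambda xb u s), xb, u, s.
by move=> _ [xb' [u' [s' [feas' ->]]]]; exact: opt.
Qed.

Hypothesis ell_ge0 : forall x u, U u -> 0 <= ell x u.
Hypothesis Vf_ge0 : forall x, 0 <= Vf x.

Lemma mpc_cost_ge0 x (u : N.-tuple 'rV[R]_m) :
  admissible f U Xb Xf x u -> 0 <= mpc_cost f ell Vf x u.
Proof.
move=> [uU _ _]; apply: addr_ge0 => //; apply: sumr_ge0 => k _.
exact/ell_ge0/uU.
Qed.

Lemma V_rs_le x xb' (u' : N.-tuple 'rV[R]_m) s' : 0 <= lambda ->
  rs_feasible f U Xb Xf Vd delta x xb' u' s' ->
  V_rs N f ell U Xb Xf Vf Vd delta lambda x <= rs_cost f ell Vf lambda xb' u' s'.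
Proof.
move=> l0 feas; apply: ge_inf; last by exists xb', u', s'.
exists 0 => _ [xb [u [s [[adm _ _] ->]]]].
apply: addr_ge0; first exact: mpc_cost_ge0 adm.
by rewrite mulr_ge0// sqr_ge0.
Qed.

Variable kf : 'rV[R]_n -> 'rV[R]_m.
Hypothesis terminal : forall z, Xf z ->
  [/\ Vf (f z (kf z)) <= Vf z - ell z (kf z), Xb z, U (kf z) & Xf (f z (kf z))].

(** Near the origin the terminal controller gives a cost of at most c_f |x|^2;
    at distance at least r from the origin the uniform bound M is itself at
    most M / r^2 times |x|^2. *)
Lemma mpc_cost_quadratic_bound (M c_f : R) :
  (forall z, Xf z -> Vf z <= c_f * enorm z ^+ 2) -> Xf° 0 ->
  (forall x (u : N.-tuple 'rV[R]_m), admissible f U Xb Xf x u ->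
    mpc_cost f ell Vf x u <= M) ->
  exists2 C, 0 < C & forall x, feasible_set N f U Xb Xf x ->
    exists2 u : N.-tuple 'rV[R]_m,
      admissible f U Xb Xf x u & mpc_cost f ell Vf x u <= C * enorm x ^+ 2.
Proof.
move=> Vf_le /nbhs_norm0P[r /= r0 rXf] Mle.
have Xf0 : Xf 0 by apply: rXf; rewrite /= normr0.
have M0 : 0 <= M.
  have [u ux _] := admissible_terminal N terminal Xf0.
  exact: le_trans (mpc_cost_ge0 ux) (Mle _ _ ux).
have Mr0 : 0 <= M / r ^+ 2 by rewrite divr_ge0// sqr_ge0.
(* the summand 1 only makes the constant positive *)
exists (1 + `|c_f| + M / r ^+ 2) => [|x [u ux]].
  by rewrite ltr_wpDr// ltr_wpDr.
have [xr|rx] := ltP (enorm x) r.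
  have xf : Xf x by apply: rXf; exact: le_lt_trans (norm_le_enorm x) xr.
  have [u' u'x u'le] := admissible_terminal N terminal xf.
  exists u' => //; rewrite (le_trans u'le)// (le_trans (Vf_le _ xf))//.
  rewrite ler_wpM2r ?sqr_ge0//; have := ler_norm c_f; lra.
exists u => //; rewrite (le_trans (Mle _ _ ux))//.
rewrite (@le_trans _ _ (M / r ^+ 2 * enorm x ^+ 2))//.
  rewrite -mulrAC ler_pdivlMr ?exprn_gt0// ler_wpM2l//.
  by rewrite ler_sqr ?nnegrE ?enorm_ge0// ltW.
rewrite ler_wpM2r ?sqr_ge0// lerDr addr_ge0//.
Qed.

Hypothesis N_gt0 : (0 < N)%N.
Hypothesis lambda_ge0 : 0 <= lambda.
Variables (rho c_4 wbar : R).
Hypothesis rho01 : 0 <= rho < 1.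
Hypothesis c4_ge0 : 0 <= c_4.
Hypothesis wbar_ge0 : 0 <= wbar.
Hypothesis delta_fixpoint : rho * delta + Num.sqrt c_4 * wbar = delta.
Hypothesis Vd_contract : forall x z (w : 'rV[R]_n) u, U u ->
  Num.sqrt (Vd (f x u + w) (f z u)) <=
  rho * Num.sqrt (Vd x z) + Num.sqrt c_4 * enorm w.

(** The tube radius delta absorbs a disturbance of size wbar, so that the
    slack contracts and only the part of w outside the ball enters it. *)
Lemma rs_feasible_step x xb (u : N.-tuple 'rV[R]_m) s (w : 'rV[R]_n) :
  rs_feasible f U Xb Xf Vd delta x xb u s ->
  exists2 u' : N.-tuple 'rV[R]_m,
    rs_feasible f U Xb Xf Vd delta (f x u`_0 + w) (f xb u`_0) u'
      (rho * s + Num.sqrt c_4 * set_dist (eball wbar) w) &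
    mpc_cost f ell Vf (f xb u`_0) u' <= mpc_cost f ell Vf xb u - ell xb u`_0.
Proof.
move=> [adm s0 sd]; have [uU _ zf] := adm; have [r0 _] := andP rho01.
have [decr zX kU zf'] := terminal zf.
have [u' [adm' cE]] := admissible_shift ell Vf N_gt0 adm kU zX zf'.
exists u'; last by move: cE decr; lra.
split=> //; first by rewrite addr_ge0 ?mulr_ge0 ?sqrtr_ge0 ?set_dist_ge0.
rewrite (le_trans (Vd_contract _ _ _ (uU 0%N N_gt0)))//.
have h1 := ler_wpM2l r0 sd.
have h2 := ler_wpM2l (sqrtr_ge0 c_4) (enorm_le_eball_dist w wbar_ge0).
rewrite (le_trans (lerD h1 h2))// -[in leRHS]delta_fixpoint; lra.
Qed.

Variables (c_l C : R).
Hypothesis c_l_gt0 : 0 < c_l.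
Hypothesis C_gt0 : 0 < C.
Hypothesis ell_lower : forall x u, U u -> c_l * enorm x ^+ 2 <= ell x u.
Hypothesis cost_upper : forall x, feasible_set N f U Xb Xf x ->
  exists2 u : N.-tuple 'rV[R]_m,
    admissible f U Xb Xf x u & mpc_cost f ell Vf x u <= C * enorm x ^+ 2.

(** The two summands of V_rs decrease separately: the slack term by the
    contraction of the slack, and the nominal cost J because the input is
    optimal for xb, whence J <= C |xb|^2 <= (C / c_l) * (first stage cost). *)
Lemma V_rs_decrease x xb (u : N.-tuple 'rV[R]_m) s (w : 'rV[R]_n) :
  rs_minimizer f ell U Xb Xf Vf Vd delta lambda x xb u s ->
  V_rs N f ell U Xb Xf Vf Vd delta lambda (f x u`_0 + w) <=
  Num.max rho (1 - c_l / C) * V_rs N f ell U Xb Xf Vf Vd delta lambda x +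
  lambda * (c_4 / (1 - rho)) * set_dist (eball wbar) w ^+ 2.
Proof.
move=> umin; have [feas opt] := umin; have [adm s0 sd] := feas.
have [u' feas' cost'] := rs_feasible_step w feas.
rewrite (le_trans (V_rs_le lambda_ge0 feas'))// (rs_minimizer_V_rs umin).
set J := mpc_cost f ell Vf xb u in cost' *.
have J0 : 0 <= J := mpc_cost_ge0 adm.
have JC : J <= C * enorm xb ^+ 2.
  have [v vadm vC] := cost_upper (ex_intro _ u adm).
  apply: le_trans vC; have /opt : rs_feasible f U Xb Xf Vd delta x xb v s by [].
  by rewrite /rs_cost lerD2r.
have Jl : J * (c_l / C) <= ell xb u`_0.
  have [uU _ _] := adm; apply: le_trans (ell_lower xb (uU 0%N N_gt0)).
  by rewrite mulrCA ler_pM2l// ler_pdivrMr// mulrC.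
set rt := Num.max _ _.
have h1 : (1 - c_l / C) * J <= rt * J by rewrite ler_wpM2r// le_max lexx orbT.
have h2 : rho * (lambda * s ^+ 2) <= rt * (lambda * s ^+ 2).
  by rewrite ler_wpM2r ?mulr_ge0 ?sqr_ge0// le_max lexx.
have := ler_wpM2l lambda_ge0
  (sqr_contraction_le rho s (Num.sqrt c_4 * set_dist (eball wbar) w) rho01).
rewrite exprMn sqr_sqrtr// => h3.
have h4 : lambda * (c_4 * set_dist (eball wbar) w ^+ 2 / (1 - rho)) =
   lambda * (c_4 / (1 - rho)) * set_dist (eball wbar) w ^+ 2 by ring.
rewrite mulrDr h4 in h3.
rewrite /rs_cost -/J; move: cost' Jl h1 h2 h3; lra.
Qed.

(** A point a + b with a feasible nominal state a and b in the inner tube needs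
    no slack, so the slack at x0 is at most sqrt c_2 times the distance of x0
    to the sum of the two sets. *)
Lemma V_rs_upper (M c_2 : R) x0 : 0 < lambda -> 0 < c_2 -> 0 < delta ->
  (forall x z, Vd x z <= c_2 * enorm (x - z) ^+ 2) ->
  (forall x (u : N.-tuple 'rV[R]_m), admissible f U Xb Xf x u ->
    mpc_cost f ell Vf x u <= M) ->
  feasible_set N f U Xb Xf !=set0 ->
  V_rs N f ell U Xb Xf Vf Vd delta lambda x0 <= M + lambda * c_2 *
    set_dist (minkowski_sum (feasible_set N f U Xb Xf) (Omega c_2 delta)) x0 ^+ 2.
Proof.
move=> l0 c20 d0 Vd_le Mle [y yX]; rewrite -lerBlDl.
have sc : 0 <= Num.sqrt c_2 := sqrtr_ge0 _.
apply: le_set_dist_sqr; last 2 first.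
- by rewrite mulr_gt0.
- move=> _ [a [u ua] [b bO <-]]; rewrite lerBlDl.
  have feas : rs_feasible f U Xb Xf Vd delta x0 a u
      (Num.sqrt c_2 * enorm (x0 - (a + b))).
    split=> //; first by rewrite mulr_ge0 ?enorm_ge0.
    rewrite (@le_trans _ _ (Num.sqrt c_2 * enorm (x0 - a)))//.
      apply: sqrtr_le_sqr; first by rewrite mulr_ge0 ?enorm_ge0.
      by rewrite exprMn sqr_sqrtr ?(ltW c20).
    have bd : Num.sqrt c_2 * enorm b <= delta.
      rewrite -ler_sqr ?nnegrE ?mulr_ge0 ?enorm_ge0 ?(ltW d0)//.
      by rewrite exprMn sqr_sqrtr ?(ltW c20).
    have -> : x0 - a = b + (x0 - (a + b)) by rewrite [RHS]addrC opprD addrA subrK.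
    by rewrite (le_trans (ler_wpM2l sc (ler_enormD _ _)))// mulrDr lerD2r.
  rewrite (le_trans (V_rs_le (ltW l0) feas))// lerD ?Mle//.
  by rewrite exprMn sqr_sqrtr ?(ltW c20)// mulrA.
- exists (y + 0), y => //; exists 0 => //.
  by rewrite /Omega/= enorm0 expr0n/= mulr0 sqr_ge0.
Qed.

End RelaxedProblem.

(** * Stability constants and the closed-loop bounds *)

Lemma quadratic_Kinf_gt0 {R : realType} (c : R) (alpha : R -> R) :
  class_Kinf alpha -> quadratic c alpha -> 0 < c.
Proof.
move=> [_ incr a0 _] q; have := incr 0 1 (lexx 0) ltr01.
by rewrite a0 q// expr1n mulr1.
Qed.

Lemma closed_pontryagin_diff {R : realType} {n : nat} (A B : set 'rV[R]_n) :
  closed A -> closed (pontryagin_diff A B).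
Proof.
move=> cA; have -> : pontryagin_diff A B =
    \bigcap_(b in B) ((fun x => x + b) @^-1` A) by [].
apply: closed_bigI => b _; apply: (closed_comp _ cA) => x _.
by apply: (@continuousD _ _ _ id (cst b)); [|exact: cst_continuous].
Qed.

Section OpenLoopStability.
#[local] Set Implicit Arguments.
#[local] Unset Strict Implicit.
Context {R : realType} {n m : nat}.
Variables (f : 'rV[R]_n -> 'rV[R]_m -> 'rV[R]_n) (U : set 'rV[R]_m).
Variables (Vd : 'rV[R]_n -> 'rV[R]_n -> R).

Lemma rho_delta_itv (c_2 c_3 : R) :
  0 < c_2 -> 0 < c_3 -> 0 <= rho_delta c_2 c_3 < 1.
Proof.
move=> c20 c30; rewrite sqrtr_ge0/= -[ltRHS]sqrtr1 ltr_sqrt//.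
by rewrite ltrBlDr ltrDl divr_gt0.
Qed.

(** With quadratic bounds Vd decreases by the factor rho^2 up to the
    disturbance term, and the square root is subadditive.  Since
    Num.sqrt vanishes on negative numbers, 1 - c_3 / c_2 <= rho^2 holds
    for all values of the constants. *)
Lemma sqrt_Vd_contract (c_2 c_3 c_4 : R) :
  0 < c_2 -> 0 < c_3 -> 0 < c_4 ->
  (forall x z, 0 <= Vd x z <= c_2 * enorm (x - z) ^+ 2) ->
  (forall x z (w : 'rV[R]_n) u, U u -> Vd (f x u + w) (f z u) - Vd x z <=
     - (c_3 * enorm (x - z) ^+ 2) + c_4 * enorm w ^+ 2) ->
  forall x z (w : 'rV[R]_n) u, U u ->
    Num.sqrt (Vd (f x u + w) (f z u)) <=
    rho_delta c_2 c_3 * Num.sqrt (Vd x z) + Num.sqrt c_4 * enorm w.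
Proof.
move=> c20 c30 c40 Vd_bound decr x z w u uU.
have /andP[V0 V2] := Vd_bound x z; set r := rho_delta c_2 c_3.
have r0 : 0 <= r := sqrtr_ge0 _.
have rlow : 1 - c_3 / c_2 <= r ^+ 2.
  have [neg|pos] := ltP (1 - c_3 / c_2) 0.
    by rewrite (le_trans (ltW neg))// sqr_ge0.
  by rewrite sqr_sqrtr.
apply: sqrtr_le_sqr; first by rewrite addr_ge0 ?mulr_ge0 ?sqrtr_ge0 ?enorm_ge0.
rewrite sqrrD !exprMn (sqr_sqrtr V0) (sqr_sqrtr (ltW c40)).
have cross : 0 <= r * Num.sqrt (Vd x z) * (Num.sqrt c_4 * enorm w).
  by rewrite !mulr_ge0 ?sqrtr_ge0 ?enorm_ge0.
have V3 : c_3 / c_2 * Vd x z <= c_3 * enorm (x - z) ^+ 2.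
  by rewrite mulrAC -mulrA ler_pM2l// ler_pdivrMr// mulrC.
have := ler_wpM2r V0 rlow; move: (decr x z w u uU) V3 cross.
rewrite -mulr_natl; lra.
Qed.

End OpenLoopStability.

Theorem theorem7 (R : realType) (n m N : nat)
    (f : 'rV[R]_n -> 'rV[R]_m -> 'rV[R]_n)
    (ell : 'rV[R]_n -> 'rV[R]_m -> R)
    (U : set 'rV[R]_m) (X Xbf : set 'rV[R]_n)
    (Vd : 'rV[R]_n -> 'rV[R]_n -> R) (Vf : 'rV[R]_n -> R)
    (wbar : R)
    (alpha_l alpha_f alpha_d1 alpha_d2 alpha_d3 alpha_d4 : R -> R)
    (c_l c_f c_d1 c_d2 c_d3 c_d4 : R) :
  let W : set 'rV[R]_n := eball wbar in
  let delta := delta_bar c_d2 c_d3 c_d4 wbar in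
  let Omega_in : set 'rV[R]_n := Omega c_d2 delta in
  let Omega_out : set 'rV[R]_n := Omega c_d1 delta in
  let Xb := pontryagin_diff X Omega_out in
  let XbN := feasible_set N f U Xb Xbf in
  let Vrs := V_rs N f ell U Xb Xbf Vf Vd delta in
  let minimizer lambda x xb (u : N.-tuple 'rV[R]_m) s :=
    rs_minimizer f ell U Xb Xbf Vf Vd delta lambda x xb u s in
  (0 < N)%N ->
  0 < wbar ->
  closed X ->
  (forall x u, U u -> 0 <= ell x u) ->
  continuous Vf ->
  (forall x, 0 <= Vf x) ->
  closed Xbf ->
  Xbf `<=` Xb ->
  regularity f ell U X alpha_l ->
  open_loop_stability f U Vd alpha_d1 alpha_d2 alpha_d3 alpha_d4 ->
  quadratic c_l alpha_l ->
  quadratic c_f alpha_f ->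
  quadratic c_d1 alpha_d1 ->
  quadratic c_d2 alpha_d2 ->
  quadratic c_d3 alpha_d3 ->
  quadratic c_d4 alpha_d4 ->
  tightened_terminal N f ell U Xb Xbf Vf alpha_f ->
  (* the minimum in the definition of V_rs is attained *)
  (forall (lambda : R) (x : 'rV[R]_n), 0 < lambda ->
     exists xb (u : N.-tuple 'rV[R]_m) s, minimizer lambda x xb u s) /\
  exists rho c_w c_X1 c_X2 c_X3 : R,
    [/\ 0 <= rho < 1, 0 <= c_w, 0 <= c_X1, 0 <= c_X2 & 0 <= c_X3] /\
    forall (x0 : 'rV[R]_n) (lambda : R) (w : nat -> 'rV[R]_n) (T : nat)
           (ustar : 'rV[R]_n -> N.-tuple 'rV[R]_m) (x : nat -> 'rV[R]_n),
      0 < lambda ->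
      (forall y, exists xb s, minimizer lambda y xb (ustar y) s) ->
      x 0%N = x0 ->
      (forall k, x k.+1 = f (x k) (ustar (x k))`_0 + w k) ->
      (forall k, Vrs lambda (x k.+1) <=
                 rho * Vrs lambda (x k) + lambda * c_w * set_dist W (w k) ^+ 2) /\
      \sum_(0 <= k < T) set_dist X (x k) ^+ 2 <=
        c_X1 * set_dist (minkowski_sum XbN Omega_in) x0 ^+ 2
        + c_X2 / lambda
        + c_X3 * \sum_(0 <= k < T) set_dist W (w k) ^+ 2.
Proof.
move=> W delta Omega_in Omega_out Xb XbN Vrs minimizer N_gt0 wbar_gt0 closed_X
  ell_ge0 cont_Vf Vf_ge0 closed_Xbf _ reg ols ql qf q1 q2 q3 q4 tt.
have c_l_gt0 := quadratic_Kinf_gt0 _ _ (reg_Kinf reg) ql.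
have c1_gt0 := quadratic_Kinf_gt0 _ _ (ols_Kinf1 ols) q1.
have c2_gt0 := quadratic_Kinf_gt0 _ _ (ols_Kinf2 ols) q2.
have c3_gt0 := quadratic_Kinf_gt0 _ _ (ols_Kinf3 ols) q3.
have c4_gt0 := quadratic_Kinf_gt0 _ _ (ols_Kinf4 ols) q4.
have ell_lower x u : U u -> c_l * enorm x ^+ 2 <= ell x u.
  move=> uU; apply: le_trans (reg_lower reg x uU).
  rewrite ql ?addr_ge0 ?enorm_ge0// ler_pM2l//.
  rewrite ler_sqr ?nnegrE ?addr_ge0 ?enorm_ge0//.
  by rewrite lerDl enorm_ge0.
have Vd_bounds x z :
    c_d1 * enorm (x - z) ^+ 2 <= Vd x z <= c_d2 * enorm (x - z) ^+ 2.
  by have := ols_bounds ols x z; rewrite q1 ?q2 ?enorm_ge0.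
have [kf terminal] : exists kf : 'rV[R]_n -> 'rV[R]_m, forall z, Xbf z ->
    [/\ Vf (f z (kf z)) <= Vf z - ell z (kf z), Xb z, U (kf z) &
      Xbf (f z (kf z))].
  by have [kf loc] := tt_local tt; exists kf => z /loc[? [? ?] ? _].
have Vf_le z : Xbf z -> Vf z <= c_f * enorm z ^+ 2.
  by have [? loc] := tt_local tt => /loc[_ _ _]; rewrite qf ?enorm_ge0.
have Xbf0 : Xbf 0 := interior_subset (tt_int tt).
have [u0 u0adm _] := admissible_terminal N terminal Xbf0.
have XbN_neq0 : XbN !=set0 by exists 0, u0.
have closed_Xb : closed Xb by exact: closed_pontryagin_diff.
have [M cost_le] := mpc_cost_bounded (reg_cont_f reg) (reg_cont_ell reg)
  (reg_compact_U reg) closed_Xb closed_Xbf cont_Vf (tt_compact tt) XbN_neq0.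
have M_ge0 : 0 <= M.
  exact: le_trans (mpc_cost_ge0 ell_ge0 Vf_ge0 u0adm) (cost_le _ _ u0adm).
have [C C_gt0 cost_quad] := mpc_cost_quadratic_bound ell_ge0 Vf_ge0 terminal
  Vf_le (tt_int tt) cost_le.
set r := rho_delta c_d2 c_d3.
have r01 : 0 <= r < 1 := rho_delta_itv c2_gt0 c3_gt0.
have r1 : 0 < 1 - r by rewrite subr_gt0; case/andP: r01.
have delta_gt0 : 0 < delta by rewrite !mulr_gt0 ?invr_gt0 ?sqrtr_gt0.
have delta_fix : r * delta + Num.sqrt c_d4 * wbar = delta.
  by rewrite /delta /delta_bar -/r; field; rewrite gt_eqF.
have contract : forall x z w u, U u ->
    Num.sqrt (Vd (f x u + w) (f z u)) <=
    r * Num.sqrt (Vd x z) + Num.sqrt c_d4 * enorm w.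
  apply: sqrt_Vd_contract => // [x z|x z w u uU].
    by rewrite (ols_ge0 ols); case/andP: (Vd_bounds x z).
  by have := ols_decrease ols x z w uU; rewrite q3 ?q4 ?enorm_ge0.
split=> [lambda x l0|].
  exact: (exists_rs_minimizer delta (reg_cont_f reg) (reg_cont_ell reg)
    (reg_compact_U reg) closed_Xb closed_Xbf cont_Vf (tt_compact tt) XbN_neq0
    (ols_cont ols) x (ltW l0)).
set rho := Num.max r (1 - c_l / C).
have rho01 : 0 <= rho < 1.
  rewrite le_max gt_max ltrBlDr ltrDl divr_gt0// andbT.
  by case/andP: r01 => -> ->.
have rho1 : 0 < 1 - rho by rewrite subr_gt0; case/andP: rho01.
have c_w_ge0 : 0 <= c_d4 / (1 - r) by rewrite divr_ge0 ?ltW.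
(* the squared violation is at most V_rs / (lambda c_d1), and summing V_rs over
   time costs the factor 1 / (1 - rho) *)
set K := c_d1 * (1 - rho); have K_gt0 : 0 < K by rewrite mulr_gt0.
exists rho, (c_d4 / (1 - r)), (c_d2 / K), (M / K), (c_d4 / (1 - r) / K).
split; first by split=> //; rewrite divr_ge0// ltW.
move=> x0 lambda w T ustar x l0 umin xE xS.
have decrease k : Vrs lambda (x k.+1) <= rho * Vrs lambda (x k) +
    lambda * (c_d4 / (1 - r)) * set_dist W (w k) ^+ 2.
  have [xb [s xbmin]] := umin (x k); rewrite xS.
  exact: (V_rs_decrease ell_ge0 Vf_ge0 terminal N_gt0 (ltW l0) r01 (ltW c4_gt0)
    (ltW wbar_gt0) delta_fix contract c_l_gt0 C_gt0 ell_lower cost_quad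
    (w k) xbmin).
split=> //.
have violation y : 0 <= Vrs lambda y /\
    lambda * c_d1 * set_dist X y ^+ 2 <= Vrs lambda y.
  have [xb [s xbmin]] := umin y; have [[adm s0 sd] _] := xbmin.
  rewrite /Vrs (rs_minimizer_V_rs xbmin) /rs_cost.
  have J0 := mpc_cost_ge0 ell_ge0 Vf_ge0 adm.
  split; first by rewrite addr_ge0// mulr_ge0 ?sqr_ge0 ?ltW.
  rewrite -[leLHS]add0r lerD// -mulrA ler_pM2l//.
  apply: (set_dist_pontryagin _ _ _ _ _ xb delta_gt0 s0); last exact: ltW.
    by have [_ /(_ 0%N N_gt0)] := adm.
  have /andP[V1 _] := Vd_bounds y xb; apply: le_trans V1 _.
  rewrite -[leLHS]sqr_sqrtr ?(ols_ge0 ols)//.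
  by rewrite ler_sqr ?nnegrE ?sqrtr_ge0 ?addr_ge0 ?(ltW delta_gt0).
have Vsum := sum_le_of_contraction _ _ _ T
  (fun k => (violation (x k)).1) decrease.
have Vx0 := V_rs_upper ell_ge0 Vf_ge0 x0 l0 c2_gt0 delta_gt0
  (fun x z => proj2 (andP (Vd_bounds x z))) cost_le XbN_neq0.
rewrite xE -mulr_sumr in Vsum.
set D0 := set_dist _ x0; set SW := \sum_(0 <= k < T) set_dist W (w k) ^+ 2.
have -> : c_d2 / K * D0 ^+ 2 + M / K / lambda + c_d4 / (1 - r) / K * SW =
    (M + lambda * c_d2 * D0 ^+ 2 + lambda * (c_d4 / (1 - r)) * SW) / (lambda * K).
  by field; rewrite !gt_eqF.
rewrite ler_pdivlMr ?mulr_gt0// mulrC.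
have Xsum : lambda * c_d1 * (\sum_(0 <= k < T) set_dist X (x k) ^+ 2) <=
    \sum_(0 <= k < T) Vrs lambda (x k).
  by rewrite mulr_sumr ler_sum// => k _; exact: (violation (x k)).2.
rewrite /K mulrA mulrAC (mulrC _ (1 - rho)).
rewrite (le_trans (ler_wpM2l (ltW rho1) Xsum))// (le_trans Vsum)//.
by rewrite lerD2r.
Qed.
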